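(* Let $A:\mathbb{R}^d\to\mathcal{G}$ be a bounded linear operator into a real Hilbert space $\mathcal{G}$, let $g\in\mathcal{G}$, $\mu>0$, and suppose $0<\tau<2/\|A\|^2$. Let the coordinates of $\mathbb{R}^d$ be partitioned into $J$ nonoverlapping groups, and write $f^{(j)}$ for the subvector of $f\in\mathbb{R}^d$ formed by the components in group $j$, $j=1,\dots,J$. Let $f_0\in\mathbb{R}^d$ be such that $\sigma_0=\|Af_0-g\|>0$, and let $\{(f_k,\sigma_k)\}_{k\ge 0}$ be defined by $$f^{(j)}_{k+1}=S^{\rm G}_{2\tau\mu\sigma_k}\Big(f^{(j)}_k+\tau\,[A^*(g-Af_k)]^{(j)}\Big)\quad (j=1,\dots,J),\qquad \sigma_{k+1}=\|Af_{k+1}-g\|,\qquad k=0,1,\dots.$$ Then the sequence $\{(f_k,\sigma_k)\}_k$ converges. If moreover $\lim_k\sigma_k>0$, then $\lim_k f_k$ is a minimizer over $\mathbb{R}^d$ of $$\Phi^{\rm G}_\mu(f)=\|Af-g\|+\mu\sum_{j=1}^J\|f^{(j)}\|.$$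
   Context: All norms $\|\cdot\|$ of vectors are Euclidean/Hilbert norms; $\|A\|$ is the operator (spectral) norm and $A^*$ the adjoint of $A$. For $t\ge 0$, the block soft-thresholding operator acts on a group vector $x$ by $S^{\rm G}_t(x)=\frac{x}{\|x\|}\max\{0,\|x\|-t/2\}$ for $x\neq 0$, and $S^{\rm G}_t(0)=0$. *)

(* Defs.v *)
(* The library equips 'rV[R]_d with the sup norm.  Its topology is the usual
   one, so the library's convergence is used in R^d, but norms of vectors of
   R^d are [enorm]. *)
From HB Require Import structures.
From mathcomp Require Export all_boot all_order all_algebra sesquilinear.
From mathcomp Require Export all_classical all_reals all_analysis.

Set Implicit Arguments.
Unset Strict Implicit.
Unset Printing Implicit Defensive.

Import Order.TTheory GRing.Theory Num.Theory.
Export numFieldNormedType.Exports.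

Local Open Scope classical_set_scope.
Local Open Scope ring_scope.

Definition edot (R : realType) (n : nat) (u v : 'rV[R]_n) : R :=
  \sum_(i < n) u 0 i * v 0 i.

Definition enorm (R : realType) (n : nat) (u : 'rV[R]_n) : R :=
  Num.sqrt (edot u u).

(* With the completeness of G this makes G a real Hilbert space: [dot] is a
   real inner product (symmetric, bilinear, positive definite) by its type. *)
Definition norm_from_dot (R : realType) (G : normedModType R)
    (dot : {dot G for idfun}) : Prop :=
  forall x : G, `|x| = Num.sqrt (dot x x).

Definition bounded_op (R : realType) (d : nat) (G : normedModType R)
    (A : 'rV[R]_d -> G) : Prop :=
  exists M : R, forall f, `|A f| <= M * enorm f.

(* The set is nonempty (it contains `|A 0|), and bounded above when A is a
   bounded operator. *)
Definition opnorm (R : realType) (d : nat) (G : normedModType R)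
    (A : 'rV[R]_d -> G) : R :=
  sup [set `|A f| | f in [set f | enorm f <= 1]].

(* The vector u determined by <f, u> = <A f, y> for all f; existence and
   uniqueness are adjointP and adjoint_unique below. *)
Definition adjoint (R : realType) (d : nat) (G : normedModType R)
    (dot : {dot G for idfun}) (A : 'rV[R]_d -> G) (y : G) : 'rV[R]_d :=
  xget 0 [set u | forall f, edot f u = dot (A f) y].

Definition subvec (R : realType) (d : nat) (B : {set 'I_d}) (f : 'rV[R]_d) :
    'rV[R]_#|B| :=
  \row_(i < #|B|) f 0 (enum_val i).

Definition softG (R : realType) (n : nat) (t : R) (x : 'rV[R]_n) : 'rV[R]_n :=
  if x == 0 then 0
  else (Num.max 0 (enorm x - t / 2) / enorm x) *: x.

Definition PhiG (R : realType) (d : nat) (G : normedModType R)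
    (A : 'rV[R]_d -> G) (g : G) (mu : R) (P : {set {set 'I_d}})
    (f : 'rV[R]_d) : R :=
  `|A f - g| + mu * \sum_(B in P) enorm (subvec B f).

Lemma adjoint_ex (R : realType) (d : nat) (G : normedModType R)
    (dot : {dot G for idfun}) (A : {linear 'rV[R]_d -> G}) (y : G) :
  forall f, edot f (\row_i dot (A (delta_mx 0 i)) y) = dot (A f) y.
Proof.
move=> f; rewrite {2}(row_sum_delta f) linear_sum linear_sumlz /edot.
by apply: eq_bigr => i _; rewrite mxE linearZ linearZl_LR.
Qed.

Lemma adjointP (R : realType) (d : nat) (G : normedModType R)
    (dot : {dot G for idfun}) (A : {linear 'rV[R]_d -> G}) (y : G) :
  forall f, edot f (adjoint dot A y) = dot (A f) y.
Proof.
rewrite /adjoint; case: xgetP => [_ -> //|/(_ _ (adjoint_ex dot A y))].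
by [].
Qed.

Lemma adjoint_unique (R : realType) (d : nat) (G : normedModType R)
    (dot : {dot G for idfun}) (A : {linear 'rV[R]_d -> G}) (y : G)
    (u : 'rV[R]_d) :
  (forall f, edot f u = dot (A f) y) -> u = adjoint dot A y.
Proof.
move=> hu; apply/rowP => i.
have E v : edot (delta_mx 0 i) v = v 0 i.
  rewrite /edot (bigD1 i) //= mxE !eqxx mul1r big1 ?addr0 // => j ji.
  by rewrite mxE (negbTE ji) andbF mul0r.
by rewrite -[LHS]E -[RHS]E hu adjointP.
Qed.

(* Main.v *)
(* The step from f = f_k to p = f_{k+1} is a proximal step for the weight
   mu sigma_k.  The variational inequality of the proximal map at h, together
   with Cauchy-Schwarz for <A f - g, A h - g> and
   2 sigma_k sigma_{k+1} <= sigma_k^2 + sigma_{k+1}^2, gives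
     |p - h|^2 <= |f - h|^2 - |f - p|^2 + tau |A (f - p)|^2
                  + 2 tau sigma_k (Phi h - Phi p).
   At h = f this bounds |f - p|^2 by a constant times Phi f - Phi p.  At a
   cluster point h = l of the iterates, |f_k - l|^2 + C Phi f_k is therefore
   nonincreasing, so the whole sequence converges to l.  Letting k tend to
   infinity for arbitrary h gives 2 tau sigma_lim (Phi l - Phi h) <= 0. *)
Require Import Defs.
From mathcomp Require Import ring lra.

Set Implicit Arguments.
Unset Strict Implicit.
Unset Printing Implicit Defensive.

Import Order.TTheory GRing.Theory Num.Theory.
Local Open Scope classical_set_scope.
Local Open Scope ring_scope.

(** * Euclidean inner product and norm on row vectors *)

Lemma edotC (R : realType) (n : nat) (u v : 'rV[R]_n) : edot u v = edot v u.
Proof. by apply: eq_bigr => i _; rewrite mulrC. Qed.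

Lemma edotDl (R : realType) (n : nat) (u v w : 'rV[R]_n) :
  edot (u + v) w = edot u w + edot v w.
Proof.
by rewrite /edot -big_split; apply: eq_bigr => i _; rewrite mxE mulrDl.
Qed.

Lemma edotZl (R : realType) (n : nat) (a : R) (u v : 'rV[R]_n) :
  edot (a *: u) v = a * edot u v.
Proof.
by rewrite /edot mulr_sumr; apply: eq_bigr => i _; rewrite mxE mulrA.
Qed.

Lemma edotBl (R : realType) (n : nat) (u v w : 'rV[R]_n) :
  edot (u - v) w = edot u w - edot v w.
Proof. by rewrite -scaleN1r edotDl edotZl mulN1r. Qed.

Lemma edotBr (R : realType) (n : nat) (u v w : 'rV[R]_n) :
  edot w (u - v) = edot w u - edot w v.
Proof. by rewrite !(edotC w) edotBl. Qed.

Lemma edotZr (R : realType) (n : nat) (a : R) (u v : 'rV[R]_n) :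
  edot u (a *: v) = a * edot u v.
Proof. by rewrite !(edotC u) edotZl. Qed.

Lemma edot0l (R : realType) (n : nat) (u : 'rV[R]_n) : edot 0 u = 0.
Proof. by rewrite -(scale0r u) edotZl mul0r. Qed.

Lemma edot_ge0 (R : realType) (n : nat) (u : 'rV[R]_n) : 0 <= edot u u.
Proof. by apply: sumr_ge0 => i _; rewrite -expr2 sqr_ge0. Qed.

Lemma enorm_ge0 (R : realType) (n : nat) (u : 'rV[R]_n) : 0 <= enorm u.
Proof. exact: sqrtr_ge0. Qed.

Lemma sqr_enorm (R : realType) (n : nat) (u : 'rV[R]_n) :
  enorm u ^+ 2 = edot u u.
Proof. by rewrite sqr_sqrtr ?edot_ge0. Qed.

Lemma enorm0 (R : realType) (n : nat) : enorm (0 : 'rV[R]_n) = 0.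
Proof. by rewrite /enorm edot0l sqrtr0. Qed.

Lemma enormZ (R : realType) (n : nat) (a : R) (u : 'rV[R]_n) :
  0 <= a -> enorm (a *: u) = a * enorm u.
Proof.
move=> a0; rewrite /enorm edotZl edotZr mulrA sqrtrM ?mulr_ge0//.
by rewrite -expr2 sqrtr_sqr ger0_norm.
Qed.

Lemma enorm_eq0 (R : realType) (n : nat) (u : 'rV[R]_n) :
  (enorm u == 0) = (u == 0).
Proof.
apply/eqP/eqP => [u0|->]; last exact: enorm0.
have /eqP := sqr_enorm u; rewrite u0 expr0n eq_sym psumr_eq0 => [/allP H|i _].
  apply/rowP => i; have := H i (mem_index_enum i).
  by rewrite mxE mulf_eq0 orbb => /eqP.
by rewrite -expr2 sqr_ge0.
Qed.

(** Expanding the square of |v| u - |u| v gives 2 |u| |v| (|u| |v| - <u, v>) >= 0, and for nonzero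
    vectors the factor |u| |v| cancels. *)
Lemma edot_le_enorm (R : realType) (n : nat) (u v : 'rV[R]_n) :
  edot u v <= enorm u * enorm v.
Proof.
have [->|u0] := eqVneq u 0; first by rewrite edot0l mulr_ge0 ?enorm_ge0.
have [->|v0] := eqVneq v 0.
  by rewrite edotC edot0l mulr_ge0 ?enorm_ge0.
have uv : 0 < enorm u * enorm v.
  by rewrite mulr_gt0// lt_neqAle enorm_ge0 eq_sym enorm_eq0 ?u0 ?v0.
have := edot_ge0 (enorm v *: u - enorm u *: v).
rewrite !(edotBl, edotBr, edotZl, edotZr) (edotC v u) -!sqr_enorm => H.
rewrite -(ler_pM2l uv); nra.
Qed.

(** * Proximal inequality for block soft-thresholding *)

(** With p the thresholded vector, x - p is a subgradient of lam |.| at p: it is x itself, of norm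
    at most lam, when p = 0, and otherwise the positive multiple of x of norm lam (zero if lam = 0).
    [softG] halves its parameter, hence [2 * lam]. *)
Lemma softG_prox (R : realType) (n : nat) (lam : R) (x h : 'rV[R]_n) :
  0 <= lam ->
  edot (x - softG (2 * lam) x) (h - softG (2 * lam) x) <=
    lam * (enorm h - enorm (softG (2 * lam) x)).
Proof.
move=> lam0; rewrite /softG (mulrC 2) mulfK ?pnatr_eq0//.
have [->|x0] := eqVneq x 0.
  by rewrite !subr0 edot0l enorm0 subr0 mulr_ge0 ?enorm_ge0.
have nx : 0 < enorm x by rewrite lt_neqAle enorm_ge0 eq_sym enorm_eq0 x0.
have xh := edot_le_enorm x h; have h0 := enorm_ge0 h.
have [xlam|lamx] := leP (enorm x - lam) 0.
  rewrite mul0r scale0r !subr0 enorm0 subr0.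
  apply: (le_trans xh); apply: ler_wpM2r => //; lra.
(* The shrinking factor: p = s x, and (1 - s) |x| = lam. *)
set s := _ / _.
have s0 : 0 <= s by rewrite divr_ge0 ?ltW.
have sx : s * enorm x = enorm x - lam by rewrite divfK ?gt_eqF.
rewrite enormZ// sx !(edotBl, edotBr, edotZl, edotZr) -sqr_enorm.
have -> : edot x h - s * enorm x ^+ 2 - (s * edot x h - s * (s * enorm x ^+ 2))
   = (1 - s) * (edot x h - (s * enorm x) * enorm x) by ring.
have s1 : (1 - s) * enorm x = lam by rewrite mulrBl sx; ring.
have s1' : 0 <= 1 - s by rewrite -(pmulr_lge0 _ nx) s1.
apply: (@le_trans _ _ ((1 - s) * (enorm x * enorm h - s * enorm x * enorm x))).
  by apply: ler_wpM2l => //; lra.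
by rewrite sx -[X in _ <= X * _]s1 le_eqVlt; apply/orP; left; apply/eqP; ring.
Qed.

Lemma edot_partition (R : realType) (d : nat) (P : {set {set 'I_d}})
    (u v : 'rV[R]_d) : finset.partition P [set: 'I_d]%SET ->
  edot u v = \sum_(B in P) edot (subvec B u) (subvec B v).
Proof.
move=> partP; have -> : edot u v = \sum_(i in [set: 'I_d]%SET) u 0 i * v 0 i.
  by apply: eq_bigl => i; rewrite finset.in_setT.
rewrite (set_partition_big _ partP).
apply: eq_bigr => B _; rewrite big_enum_val.
by apply: eq_bigr => i _; rewrite !mxE.
Qed.

(** Inner product and penalty are both sums over the blocks, so the one-block inequalities add
    up. *)
Lemma groups_prox (R : realType) (d : nat) (P : {set {set 'I_d}})
    (lam : R) (x p h : 'rV[R]_d) : finset.partition P [set: 'I_d]%SET ->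
  0 <= lam -> (forall B, B \in P -> subvec B p = softG (2 * lam) (subvec B x)) ->
  edot (x - p) (h - p) <=
    lam * (\sum_(B in P) enorm (subvec B h) - \sum_(B in P) enorm (subvec B p)).
Proof.
move=> partP lam0 pE; rewrite (edot_partition _ _ partP) -sumrB mulr_sumr.
apply: ler_sum => B BP.
have subvecB (v w : 'rV[R]_d) : subvec B (v - w) = subvec B v - subvec B w.
  by apply/rowP => i; rewrite !mxE.
by rewrite !subvecB pE//; exact: softG_prox.
Qed.

(** * Inner product of [G], operator norm and step-size bound *)

Lemma norm_sqr_dot (R : realType) (G : normedModType R)
    (dot : {dot G for idfun}) (x : G) : norm_from_dot dot ->
  `|x| ^+ 2 = dot x x.
Proof.
move=> dotN; rewrite dotN sqr_sqrtr//.
have [->|x0] := eqVneq x 0; first by rewrite linear0l.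
exact/ltW/neq0_dnorm_gt0.
Qed.

Lemma dot_normB (R : realType) (G : normedModType R)
    (dot : {dot G for idfun}) (x y : G) : norm_from_dot dot ->
  `|x - y| ^+ 2 = `|x| ^+ 2 - 2 * dot x y + `|y| ^+ 2.
Proof.
move=> dotN; rewrite !(norm_sqr_dot _ dotN) linearBl linearBr /= linearBr /=.
by rewrite (hermC dot y x) /= expr0 mul1r; ring.
Qed.

(** Here Cauchy-Schwarz comes from the triangle inequality of the given norm, by squaring |x + y| <=
    |x| + |y|. *)
Lemma dot_le_norm (R : realType) (G : normedModType R)
    (dot : {dot G for idfun}) (x y : G) : norm_from_dot dot ->
  dot x y <= `|x| * `|y|.
Proof.
move=> dotN; have := dot_normB (dot := dot) x (- y) dotN.
rewrite opprK linearNr normrN => E.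
have : `|x + y| ^+ 2 <= (`|x| + `|y|) ^+ 2.
  by rewrite ler_pXn2r ?nnegrE ?addr_ge0 ?ler_normD.
by rewrite E; lra.
Qed.

Lemma opnorm_ge0_le (R : realType) (d : nat) (G : normedModType R)
    (A : {linear 'rV[R]_d -> G}) : bounded_op A ->
  0 <= opnorm A /\ forall f, `|A f| <= opnorm A * enorm f.
Proof.
case=> M AM.
set S := [set `|A f| | f in [set f | enorm f <= 1]].
(* The constant [M] may be negative, so [|M|] is taken as the bound on the unit ball. *)
have ubS : has_ubound S.
  exists `|M| => _ [f /= f1 <-]; apply: (le_trans (AM f)).
  apply: (@le_trans _ _ (`|M| * enorm f)).
    by rewrite ler_wpM2r ?enorm_ge0 ?ler_norm.
  by rewrite ler_piMr.
have leS f : enorm f <= 1 -> `|A f| <= opnorm A.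
  by move=> f1; apply: ub_le_sup => //; exists f.
split; first by apply: le_trans (leS 0 _); rewrite ?enorm0 ?ler01.
move=> f; have [->|f0] := eqVneq f 0; first by rewrite linear0 normr0 enorm0 mulr0.
have nf : 0 < enorm f by rewrite lt_neqAle enorm_ge0 eq_sym enorm_eq0 f0.
have nfV : 0 <= (enorm f)^-1 by rewrite invr_ge0 ltW.
have := leS ((enorm f)^-1 *: f); rewrite enormZ// mulVf ?gt_eqF//
  => /(_ (lexx _)).
by rewrite linearZ /= normrZ (ger0_norm nfV) mulrC ler_pdivrMr.
Qed.

(** When L = 0 the quotient is +oo and the conclusion reads 0 < 2. *)
Lemma lte_div_sqr (R : realType) (tau L : R) : 0 <= L ->
  (tau%:E < 2%:E / (L ^+ 2)%:E)%E -> tau * L ^+ 2 < 2.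
Proof.
move=> L0; rewrite inver; case: eqP => [->|/eqP L2]; first by rewrite mulr0.
have L2p : 0 < L ^+ 2 by rewrite lt_neqAle eq_sym L2 sqr_ge0.
by rewrite -EFinM lte_fin ltr_pdivlMr.
Qed.

(** * One-step inequality of the iteration *)

Lemma PhiG_step (R : realType) (d : nat) (G : normedModType R)
    (dot : {dot G for idfun}) (A : {linear 'rV[R]_d -> G}) (g : G) (mu tau : R)
    (P : {set {set 'I_d}}) (f p h : 'rV[R]_d) :
  norm_from_dot dot -> finset.partition P [set: 'I_d]%SET ->
  0 <= mu -> 0 <= tau ->
  (forall B, B \in P -> subvec B p = softG (2 * tau * mu * `|A f - g|)
      (subvec B f + tau *: subvec B (adjoint dot A (g - A f)))) ->
  edot (p - h) (p - h) <= edot (f - h) (f - h) - edot (f - p) (f - p)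
    + tau * `|A (f - p)| ^+ 2
    + 2 * tau * `|A f - g| * (PhiG A g mu P h - PhiG A g mu P p).
Proof.
move=> dotN partP mu0 tau0 pE.
set s := `|A f - g| in pE *; have s0 : 0 <= s by rewrite normr_ge0.
set q := adjoint dot A (g - A f) in pE.
have := @groups_prox R d P (tau * mu * s) (f + tau *: q) p h partP.
have lam0 : 0 <= tau * mu * s by rewrite !mulr_ge0.
have softE B : softG (2 * tau * mu * s) (subvec B f + tau *: subvec B q) =
    softG (2 * (tau * mu * s)) (subvec B (f + tau *: q)).
  by rewrite !mulrA; congr softG; apply/rowP => i; rewrite !mxE.
move=> /(_ lam0 (fun B BP => etrans (pE B BP) (softE B))) prox.
have {prox} : edot (f - p) (h - p) + tau * dot (A (h - p)) (g - A f) <=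
    tau * mu * s *
      (\sum_(B in P) enorm (subvec B h) - \sum_(B in P) enorm (subvec B p)).
  by apply: le_trans prox; rewrite (addrAC f) (edotDl (f - p)) edotZl
    (edotC q) adjointP.
have rE : A (h - p) = (A h - g) - (A p - g).
  by rewrite linearB /= opprB addrA subrK.
have -> : dot (A (h - p)) (g - A f) =
    dot (A p - g) (A f - g) - dot (A h - g) (A f - g).
  by rewrite rE -(opprB (A f)) linearNr linearBl opprB.
have cs : dot (A h - g) (A f - g) <= `|A h - g| * s by exact: dot_le_norm.
(* Polarization expresses <A p - g, A f - g> through the two residual norms and |A (f - p)|. *)
have := dot_normB (dot := dot) (A p - g) (A f - g) dotN.
have -> : `|A p - g - (A f - g)| = `|A (f - p)|.
  by rewrite [in RHS]linearB distrC opprB addrA subrK.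
rewrite -/s /PhiG.
have amgm : 0 <= (s - `|A p - g|) ^+ 2 by exact: sqr_ge0.
set Oh := \sum_(B in P) _; set Op := \sum_(B in P) _.
set b := dot (A p - g) _ in cs *; set c := dot _ _ in cs *.
(* Three-point identity; its cross term is the one bounded by [prox]. *)
have -> : edot (p - h) (p - h) =
    edot (f - h) (f - h) - edot (f - p) (f - p) + 2 * edot (f - p) (h - p).
  rewrite !(edotBl, edotBr) (edotC p f) (edotC h f) (edotC h p); ring.
move: cs amgm; set e := edot (f - p) (h - p).
set rh := `|A h - g|; set rp := `|A p - g|; set w := `|A _|.
move=> cs amgm wE He.
(* Replacing -(rp^2 + s^2) / 2 by the larger -rp s leaves the common factor s, so that s (rh - rp)
   joins the penalty terms to form s (Phi h - Phi p). *)
have : tau * (c - b) <= tau * (rh * s + (w ^+ 2 - rp ^+ 2 - s ^+ 2) / 2).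
  by apply: ler_wpM2l => //; lra.
have : tau * ((rp - s) ^+ 2) >= 0 by rewrite mulr_ge0// sqr_ge0.
by nra.
Qed.

(** * Coordinate bounds and continuity *)

Lemma coord_le_enorm (R : realType) (n : nat) (u : 'rV[R]_n) (i : 'I_n) :
  `|u 0 i| <= enorm u.
Proof.
rewrite -sqrtr_sqr ler_wsqrtr// /edot (bigD1 i)//= -expr2 lerDl.
by apply: sumr_ge0 => j _; rewrite -expr2 sqr_ge0.
Qed.

(** Turns Euclidean estimates into convergence for the sup norm of the library. *)
Lemma mx_norm_le_enorm (R : realType) (n : nat) (u : 'rV[R]_n) :
  `|u| <= enorm u.
Proof.
rewrite [leLHS]mx_normrE; apply: bigmax_le; first exact: enorm_ge0.
by case=> i j _ /=; rewrite ord1; exact: coord_le_enorm.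
Qed.

(** The block containing [i] already dominates the coordinate. For mu > 0 this makes the sublevel
    sets of [PhiG] bounded. *)
Lemma coord_le_group_norms (R : realType) (d : nat) (P : {set {set 'I_d}})
    (u : 'rV[R]_d) (i : 'I_d) : finset.partition P [set: 'I_d]%SET ->
  `|u 0 i| <= \sum_(B in P) enorm (subvec B u).
Proof.
move=> partP.
have iP : i \in finset.cover P by rewrite (cover_partition partP) finset.in_setT.
have iB : i \in finset.pblock P i by rewrite mem_pblock.
rewrite (bigD1 (finset.pblock P i)) ?pblock_mem//=.
apply: ler_wpDr; first by apply: sumr_ge0 => B _; exact: enorm_ge0.
apply: le_trans (coord_le_enorm _ (enum_rank_in iB i)).
by rewrite mxE enum_rankK_in.
Qed.

Lemma continuous_sum (R : realType) (T : topologicalType) (V : normedModType R)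
    (I : Type) (r : seq I) (Q : pred I) (F : I -> T -> V) :
  (forall i, Q i -> continuous (F i)) ->
  continuous (fun x => \sum_(i <- r | Q i) F i x).
Proof. by apply: continuous_big; exact: add_continuous. Qed.

Lemma enorm_continuous (R : realType) (n : nat) :
  continuous (@enorm R n).
Proof.
move=> u; apply: continuous_comp; last exact: sqrt_continuous.
apply: (@continuous_sum R _ R^o) => i _ v.
by apply: (@continuousM R _ (fun w : 'rV[R]_n => w 0 i) (fun w => w 0 i));
  exact: coord_continuous.
Qed.

Lemma sqr_dist_continuous (R : realType) (d : nat) (l : 'rV[R]_d) :
  continuous (fun h : 'rV[R]_d => enorm (h - l) ^+ 2).
Proof.
have subc : continuous (fun h : 'rV[R]_d => h - l).
  move=> h; apply: (@cvgB R _ _ (nbhs h) _ id (cst l));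
    [exact: cvg_id | exact: cvg_cst].
have normc : continuous (fun h : 'rV[R]_d => enorm (h - l)).
  move=> h; apply: (@continuous_comp _ _ _
    (fun h : 'rV[R]_d => h - l) (@enorm R d)).
    exact: subc.
  exact: enorm_continuous.
move=> h; apply: (@continuousM R _ (fun h : 'rV[R]_d => enorm (h - l)));
  exact: normc.
Qed.

Lemma subvec_enorm_continuous (R : realType) (d : nat) (B : {set 'I_d}) :
  continuous (fun f : 'rV[R]_d => enorm (subvec B f)).
Proof.
move=> u; apply: (@continuous_comp _ _ _
  (fun f : 'rV[R]_d => edot (subvec B f) (subvec B f)));
  last exact: sqrt_continuous.
apply: (@continuous_sum R _ R^o) => i _ v.
under eq_fun do rewrite !mxE.
by apply: (@continuousM R _ (fun w : 'rV[R]_d => w 0 (enum_val i))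
  (fun w => w 0 (enum_val i))); exact: coord_continuous.
Qed.

(** On a finite-dimensional domain A f is the finite sum of the f_i A e_i, and coordinates are
    continuous. *)
Lemma linear_rV_continuous (R : realType) (d : nat) (G : normedModType R)
    (A : {linear 'rV[R]_d -> G}) : continuous A.
Proof.
have -> : A = (fun f : 'rV[R]_d => \sum_i f 0 i *: A (delta_mx 0 i)) :> (_ -> _).
  apply/funext => f; rewrite {1}(row_sum_delta f) linear_sum.
  by apply: eq_bigr => i _; rewrite linearZ.
apply: continuous_sum => i _ v.
by apply: (@cvgZr_tmp R G _ (nbhs v) _ (fun f : 'rV[R]_d => f 0 i));
  exact: coord_continuous.
Qed.

Lemma residual_continuous (R : realType) (d : nat) (G : normedModType R)
    (A : {linear 'rV[R]_d -> G}) (g : G) : continuous (fun f => `|A f - g|).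
Proof.
move=> f; apply: (@cvg_norm _ _ _ (nbhs f)).
by apply: cvgB; [exact: linear_rV_continuous | exact: cvg_cst].
Qed.

Lemma PhiG_continuous (R : realType) (d : nat) (G : normedModType R)
    (A : {linear 'rV[R]_d -> G}) (g : G) (mu : R) (P : {set {set 'I_d}}) :
  continuous (PhiG A g mu P).
Proof.
move=> f; apply: (@cvgD R R^o _ (nbhs f) _ (fun f => `|A f - g|)
  (fun f => mu * \sum_(B in P) enorm (subvec B f)));
  first exact: residual_continuous.
apply: cvgMl_tmp; apply: (@continuous_sum R _ R^o) => B _.
exact: subvec_enorm_continuous.
Qed.

(** * Convergence of quasi-Fejer sequences *)

Lemma quasi_fejer_cvg (R : realType) (d : nat) (f : nat -> 'rV[R]_d)
    (Phi : 'rV[R]_d -> R) (C M : R) :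
  continuous Phi -> 0 < C -> (forall k (i : 'I_d), `|f k 0 i| <= M) ->
  (forall k, enorm (f k.+1 - f k) ^+ 2 <= C * (Phi (f k) - Phi (f k.+1))) ->
  (forall h k, Phi h <= Phi (f k.+1) ->
     enorm (f k.+1 - h) ^+ 2 <=
       enorm (f k - h) ^+ 2 + enorm (f k.+1 - f k) ^+ 2) ->
  exists l : 'rV[R]_d, f @ \oo --> l.
Proof.
move=> Phic C0 fM dec fejer.
have Phi_le m n : (m <= n)%N -> Phi (f n) <= Phi (f m).
  move=> /subnKC <-; elim: (n - m)%N => [|k IH]; first by rewrite addn0.
  rewrite addnS; apply: le_trans IH; rewrite -subr_ge0 -(pmulr_rge0 _ C0).
  exact: le_trans (sqr_ge0 _) (dec _).
have K : compact [set v : 'rV[R]_d | forall i, `[- M, M]%classic (v ord0 i)].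
  by apply: (@rV_compact R d (fun=> `[- M, M]%classic)) => i; exact: segment_compact.
have [|l [_ lcl]] := K (f @ \oo) _.
  by exists 0%N => // k _ i /=; rewrite in_itv /= -ler_norml.
have frequently (U : set 'rV[R]_d) N : nbhs l U -> exists2 k, (N <= k)%N & U (f k).
  move=> lU; have [|_ [[k Nk <-] Uk]] := lcl (f @` [set k | (N <= k)%N]) U _ lU.
    by exists N => // k Nk; exists k.
  by exists k.
(* Otherwise Phi exceeds Phi (f k) near [l], where some later iterate lies, against monotonicity. *)
have Phil k : Phi l <= Phi (f k).
  rewrite leNgt; apply/negP => lt.
  have [n kn] := frequently _ k (cvgr_gt _ (Phic l) _ lt).
  by move/(le_lt_trans (Phi_le _ _ kn)); rewrite ltxx.
exists l.
(* Lyapunov function: the decrease of C Phi pays for the error term in [fejer]. *)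
pose a (h : 'rV[R]_d) := enorm (h - l) ^+ 2 + C * (Phi h - Phi l).
have a_le m n : (m <= n)%N -> a (f n) <= a (f m).
  move=> /subnKC <-; elim: (n - m)%N => [|k IH]; first by rewrite addn0.
  rewrite addnS; apply: le_trans IH; rewrite /a.
  have := fejer l (m + k)%N (Phil _); have := dec (m + k)%N; nra.
have ac : continuous a.
  move=> h; apply: (@cvgD R R^o _ (nbhs h) _ (fun h : 'rV[R]_d => enorm (h - l) ^+ 2)
    (fun h => C * (Phi h - Phi l))); first exact: sqr_dist_continuous.
  by apply: cvgMl_tmp; apply: cvgB; [exact: Phic | exact: cvg_cst].
have al : a l = 0 by rewrite /a !subrr enorm0 expr0n mulr0 addr0.
apply/cvgrPdist_lt => e e0.
have e20 : a l < e ^+ 2 by rewrite al exprn_gt0.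
(* A single visit close to [l] suffices, since [a] does not increase afterwards and bounds the
   squared distance to [l]. *)
have [N _ Ne] := frequently _ 0%N (cvgr_lt _ (ac l) _ e20).
exists N => // k /= Nk.
rewrite distrC; apply: le_lt_trans (mx_norm_le_enorm _) _.
rewrite -(ltr_pXn2r (n := 2)) ?nnegrE ?enorm_ge0 ?ltW//.
apply: le_lt_trans Ne; apply: le_trans (a_le _ _ Nk).
by rewrite lerDl mulr_ge0 ?subr_ge0// ltW.
Qed.

(** * Convergence of the iteration and minimality of the limit *)

Unset Implicit Arguments.

Theorem theorem2 (R : realType) (d : nat) (G : completeNormedModType R)
    (dot : {dot G for idfun}) (dot_norm : norm_from_dot dot)
    (A : {linear 'rV[R]_d -> G}) (A_bounded : bounded_op A)
    (g : G) (mu : R) (mu_gt0 : 0 < mu)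
    (tau : R) (tau_gt0 : 0 < tau)
    (* in the extended reals, where 2 / 0 = +oo *)
    (tau_lt : (tau%:E < 2%:E / (opnorm A ^+ 2)%:E)%E)
    (P : {set {set 'I_d}}) (partP : finset.partition P [set: 'I_d]%SET)
    (f : nat -> 'rV[R]_d) (sigma : nat -> R)
    (sigma0 : sigma 0%N = `|A (f 0%N) - g|) (sigma0_gt0 : 0 < sigma 0%N)
    (f_rec : forall (k : nat) (B : {set 'I_d}), B \in P ->
       subvec B (f k.+1) =
       softG (2 * tau * mu * sigma k)
         (subvec B (f k) + tau *: subvec B (adjoint dot A (g - A (f k)))))
    (sigma_rec : forall k : nat, sigma k.+1 = `|A (f k.+1) - g|) :
  exists (f_lim : 'rV[R]_d) (sigma_lim : R),
    (fun k : nat => (f k, sigma k)) @ \oo --> (f_lim, sigma_lim) /\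
    (0 < sigma_lim ->
     forall h : 'rV[R]_d, PhiG A g mu P f_lim <= PhiG A g mu P h).
Proof.
have [L0 AL] := opnorm_ge0_le A_bounded.
set L := opnorm A in tau_lt L0 AL.
have tauL := lte_div_sqr L0 tau_lt.
have sE k : sigma k = `|A (f k) - g| by case: k.
have s0 k : 0 <= sigma k by rewrite sE.
pose Phi := PhiG A g mu P.
pose D k := enorm (f k.+1 - f k) ^+ 2.
have Dfk k : edot (f k - f k.+1) (f k - f k.+1) = D k.
  by rewrite /D sqr_enorm !(edotBl, edotBr); ring.
have D0 k : 0 <= D k by exact: sqr_ge0.
(* The coefficient 1 - tau L^2 may be negative; only 2 - tau L^2 > 0 is known. *)
have step k h : enorm (f k.+1 - h) ^+ 2 <= enorm (f k - h) ^+ 2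
    - (1 - tau * L ^+ 2) * D k + 2 * tau * sigma k * (Phi h - Phi (f k.+1)).
  rewrite !sqr_enorm sE.
  apply: le_trans (PhiG_step (g := g) (mu := mu) (f := f k) h dot_norm partP
    (ltW mu_gt0) (ltW tau_gt0) _) _.
    by move=> B BP; rewrite f_rec// sE.
  rewrite lerD2r Dfk mulrBl mul1r opprB -addrA lerD2l addrC lerD2r -mulrA.
  rewrite ler_wpM2l ?(ltW tau_gt0)// -Dfk -sqr_enorm -exprMn.
  by rewrite ler_pXn2r ?nnegrE ?mulr_ge0 ?enorm_ge0.
have decr k : (2 - tau * L ^+ 2) * D k <=
    2 * tau * sigma k * (Phi (f k) - Phi (f k.+1)).
  have := step k (f k); rewrite subrr enorm0 expr0n /= -/(D k); lra.
(* As sigma_k may vanish, [decr] cannot be divided by it. If Phi increased, [decr] would force D k =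
   0, hence equal iterates and equal values. *)
have Phi_decr k : Phi (f k.+1) <= Phi (f k).
  rewrite leNgt; apply/negP => lt.
  have rhs_le0 : 2 * tau * sigma k * (Phi (f k) - Phi (f k.+1)) <= 0.
    by rewrite mulr_ge0_le0 ?subr_le0 ?(ltW lt)// !mulr_ge0// ltW.
  have : D k <= 0.
    by rewrite -(pmulr_rle0 _ (x := 2 - tau * L ^+ 2)) ?subr_gt0// (le_trans (decr k)).
  rewrite le_eqVlt ltNge D0 orbF /D sqrf_eq0 enorm_eq0 subr_eq0 => /eqP fE.
  by move: lt; rewrite fE ltxx.
have Phi_le0 k : Phi (f k) <= Phi (f 0%N).
  by elim: k => // k IH; exact: le_trans IH.
have Om0 h : 0 <= \sum_(B in P) enorm (subvec B h).
  by apply: sumr_ge0 => B _; exact: enorm_ge0.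
have s_le k : sigma k <= Phi (f 0%N).
  by apply: le_trans (Phi_le0 k); rewrite sE lerDl mulr_ge0 ?Om0 ?ltW.
have Phi00 : 0 < Phi (f 0%N) by exact: lt_le_trans (s_le 0%N).
(* Comes from [decr] with sigma_k replaced by its uniform bound Phi (f 0), which is positive because
   sigma_0 is. *)
pose C := 2 * tau * Phi (f 0%N) / (2 - tau * L ^+ 2).
have cp : 0 < 2 - tau * L ^+ 2 by rewrite subr_gt0.
have C0 : 0 < C by rewrite divr_gt0// !mulr_gt0.
have DC k : D k <= C * (Phi (f k) - Phi (f k.+1)).
  rewrite -(ler_pM2l cp) (mulrA _ C) (mulrC _ C) divfK ?gt_eqF//.
  apply: le_trans (decr k) _.
  by rewrite ler_wpM2r ?subr_ge0// ler_wpM2l// mulr_ge0// ltW.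
have [||||l fl] := @quasi_fejer_cvg R d f Phi C (Phi (f 0%N) / mu) _ C0.
- exact: PhiG_continuous.
- move=> k i; rewrite ler_pdivlMr// mulrC.
  apply: le_trans (Phi_le0 k); apply: ler_wpDl => //.
  by rewrite ler_pM2l//; exact: coord_le_group_norms.
- exact: DC.
(* Since tau L^2 < 2, the term -(1 - tau L^2) D k is at most D k. *)
- move=> h k hk; apply: le_trans (step k h) _; rewrite -/(D k).
  have : 2 * tau * sigma k * (Phi h - Phi (f k.+1)) <= 0.
    by rewrite mulr_ge0_le0 ?subr_le0// !mulr_ge0// ltW.
  by have := D0 k; nra.
have cont_lim (F : 'rV[R]_d -> R) : continuous F -> F (f k) @[k --> \oo] --> F l.
  by move=> Fc; exact: (cvg_comp f F fl (Fc l)).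
have sl : sigma @ \oo --> `|A l - g|.
  rewrite (_ : sigma = fun k => `|A (f k) - g|); last exact/funext.
  by apply: (cont_lim (fun h => `|A h - g|)); exact: residual_continuous.
exists l, `|A l - g|; split; first exact: (cvg_pair fl sl).
move=> sl0 h; rewrite -subr_le0.
(* For any [h], [step] and [DC] bound 2 tau sigma_k (Phi (f k.+1) - Phi h) by b (f k) - b (f k.+1),
   which tends to 0. *)
pose b (x : 'rV[R]_d) := enorm (x - h) ^+ 2 + C * Phi x.
have Phil : Phi (f k) @[k --> \oo] --> Phi l by exact/cont_lim/PhiG_continuous.
have bl : b (f k) @[k --> \oo] --> b l.
  apply: (@cvgD R R^o _ _ _ (fun k => enorm (f k - h) ^+ 2) (fun k => C * Phi (f k))).
    by apply: (cont_lim (fun x => enorm (x - h) ^+ 2)); exact: sqr_dist_continuous.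
  exact: cvgMl_tmp.
(* Positivity of the limit of sigma allows the goal to be multiplied by this factor; 0 is written as
   the limit of the differences of [b]. *)
rewrite -(pmulr_rle0 _ (x := 2 * tau * `|A l - g|)) ?mulr_gt0// -(subrr (b l)).
have sPhi : 2 * tau * sigma k * (Phi (f k.+1) - Phi h) @[k --> \oo] -->
    2 * tau * `|A l - g| * (Phi l - Phi h).
  apply: (cvgM (f := fun k => 2 * tau * sigma k) (g := fun k => Phi (f k.+1) - Phi h)).
    exact: cvgMl_tmp.
  apply: (@cvgB R R^o _ _ _ (fun k => Phi (f k.+1)) (cst (Phi h))); last exact: cvg_cst.
  by have := Phil; rewrite -cvg_shiftS.
have bb : b (f k) - b (f k.+1) @[k --> \oo] --> b l - b l.
  apply: (@cvgB R R^o _ _ _ (fun k => b (f k)) (fun k => b (f k.+1))) => //.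
  by have := bl; rewrite -cvg_shiftS.
apply: (ler_cvg_to sPhi bb); apply: nearW => k.
have := step k h; have := DC k; have := D0 k.
have : 0 <= tau * L ^+ 2 by rewrite mulr_ge0 ?sqr_ge0// ltW.
rewrite /b; nra.
Qed.
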